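(* Let $n\ge 1$ and assume that $Q_n(w)$ has simple zeros only. Then the residues $\rho_j^n$ of $Z_{[n-1/n]}(w)=s_0wP_n(w)/Q_n(w)$ at the poles $z_j^n$ ($j=0,\dots,n-1$) are given by each of the following three formulas: $$\rho_j^n=s_0z_j^n\,\frac{\prod_{i=1}^{n-1}(z_j^n-\lambda_i^n)}{\prod_{i=0,\ i\neq j}^{n-1}(z_j^n-z_i^n)},$$ $$\rho_j^n=s_0z_j^n\,\frac{P_n(z_j^n)}{Q_n'(z_j^n)},$$ $$\rho_j^n=s_0z_j^n\,T_n^{-1}[j,0],$$ where $T_n=[Q_i(z_j^n)]_{i,j=0}^{n-1}$ is the matrix diagonalizing $J_n$, i.e. $J_n=T_n\operatorname{diag}(z_0^n,\dots,z_{n-1}^n)T_n^{-1}$.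
   Context: Let $n\ge1$ and $s_0,\dots,s_{2n-1}\in\mathbb C$. Define $f_l^k$ by $f_{-2}^k=f_{-1}^k=\delta_{0,k}$, $f_0^k=s_k$, and $f_{l+1}^k=\frac{(-1)^l}{f_{l-2}^0}\left[f_l^0f_{l-1}^{k+1}-f_{l-1}^0f_l^{k+1}\right]$ for $l\ge 0$ ($f_l^k$ depends only on $s_0,\dots,s_{l+k}$). Standing assumption: $f_l^0\ne 0$ for $0\le l\le 2n-1$. Put $r_l=(-1)^{l-1}\frac{f_l^0f_{l-3}^0}{f_{l-2}^0f_{l-1}^0}$ for $1\le l\le 2n-1$, $c_0=-r_1$, and for $1\le l\le n-1$: $c_l=-(r_{2l}+r_{2l+1})$, $d_l=r_{2l-1}r_{2l}$. Monic polynomials $P_l,Q_l$ ($0\le l\le n$) are given by $P_0=0$, $P_1=1$, $Q_0=1$, $Q_1(w)=w+r_1$ and, for $1\le l\le n-1$, $$P_{l+1}(w)=(w-c_l)P_l(w)-d_lP_{l-1}(w),\qquad Q_{l+1}(w)=(w-c_l)Q_l(w)-d_lQ_{l-1}(w).$$ $J_n$ is the $n\times n$ tridiagonal matrix with diagonal $c_0,\dots,c_{n-1}$, superdiagonal entries all $1$, and subdiagonal $d_1,\dots,d_{n-1}$. The zeros of $Q_n$ are $z_0^n,\dots,z_{n-1}^n$ and the zeros of $P_n$ (with multiplicity) are $\lambda_1^n,\dots,\lambda_{n-1}^n$. The rational function $Z_{[n-1/n]}(w)=s_0wP_n(w)/Q_n(w)$ is the $[n-1/n]$ Padé approximation of $\sum_k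 s_kz^k$ written in the variable $w=z^{-1}$. Matrix indices run from $0$ to $n-1$. *)

(* Defs.v *)
From HB Require Import structures.
From mathcomp Require Import all_boot all_order all_algebra.
From mathcomp Require Import boolp classical_sets reals.
From mathcomp Require Import complex.

Set Implicit Arguments.
Unset Strict Implicit.
Unset Printing Implicit Defensive.

Import GRing.Theory.
Local Open Scope ring_scope.

Section PadeData.
Variables (K : fieldType) (s : nat -> K).

(* The lower index is shifted by 2: [ftab m k] is $f_{m-2}^k$.  The last clause
   is the recursion for $f_{l+1}^k$ with $m = l + 3$. *)
Fixpoint ftab (m k : nat) {struct m} : K :=
  match m with
  | 0 => (k == 0%N)%:R
  | 1 => (k == 0%N)%:R
  | 2 => s k
  | ((l.+1 as l1).+1 as l2).+1 =>
      (-1) ^+ l / ftab l 0 *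
        (ftab l2 0 * ftab l1 k.+1 - ftab l1 0 * ftab l2 k.+1)
  end.

(* $r_l$, meaningful for l >= 1 only; the shift by 2 turns
   $f_l, f_{l-1}, f_{l-2}, f_{l-3}$ into the rows l+2, l+1, l, l-1. *)
Definition rcoef (l : nat) : K :=
  (-1) ^+ l.-1 * ((ftab l.+2 0 * ftab l.-1 0) / (ftab l 0 * ftab l.+1 0)).

Definition ccoef (l : nat) : K :=
  if l is 0 then - rcoef 1 else - (rcoef (2 * l) + rcoef (2 * l).+1).

(* Meaningful for l >= 1 only. *)
Definition dcoef (l : nat) : K := rcoef (2 * l).-1 * rcoef (2 * l).

Fixpoint Ppol (m : nat) : {poly K} :=
  match m with
  | 0 => 0
  | 1 => 1
  | (l.+1 as l1).+1 =>
      ('X - (ccoef l1)%:P) * Ppol l1 - (dcoef l1)%:P * Ppol l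
  end.

Fixpoint Qpol (m : nat) : {poly K} :=
  match m with
  | 0 => 1
  | 1 => 'X + (rcoef 1)%:P
  | (l.+1 as l1).+1 =>
      ('X - (ccoef l1)%:P) * Qpol l1 - (dcoef l1)%:P * Qpol l
  end.

Definition Jmx (n : nat) : 'M[K]_n :=
  \matrix_(i, j)
    (if i == j then ccoef i
     else if j == i.+1 :> nat then 1
     else if i == j.+1 :> nat then dcoef i
     else 0).

Definition Tmx (n : nat) (z : n.-tuple K) : 'M[K]_n :=
  \matrix_(i, j) (Qpol i).[tnth z j].

Definition Zpade (n : nat) : {fraction {poly K}} :=
  tofrac (s 0 *: ('X * Ppol n)) / tofrac (Qpol n).

End PadeData.

Section Zeros.
Variable K : fieldType.

(* The list [z] enumerates the zeros of [p], repeated with multiplicity. *)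
Definition zeros_of (p : {poly K}) (z : seq K) : Prop :=
  forall x : K, count_mem x z = mup x p.

Definition simple_zeros (p : {poly K}) : Prop :=
  forall x : K, root p x -> mup x p = 1%N.

End Zeros.

Lemma mulVX_exp (L : fieldType) (x : L) (m k : nat) :
  x != 0 -> (k < m.+1)%N -> x ^- k.+1 * x ^+ m.+1 = x ^+ (m - k).
Proof.
move=> x0 km; have e : m.+1 = (k.+1 + (m - k))%N by rewrite addSn subnKC.
by rewrite e exprD mulKf ?expf_neq0.
Qed.

Section Residues.
Variable K : fieldType.
Implicit Types (F h : {fraction {poly K}}) (z a : K).

Definition regular_at F z : Prop :=
  exists u v : {poly K}, v.[z] != 0 /\ F = tofrac u / tofrac v.

Definition is_pole F z : Prop := ~ regular_at F z.

(* $\sum_{k < m} c_k (w - z)^{-(k+1)}$ *)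
Definition principal_part (m : nat) (c : nat -> K) z : {fraction {poly K}} :=
  \sum_(k < m) tofrac (c k)%:P / tofrac ('X - z%:P) ^+ k.+1.

(* [a] is the coefficient of $(w - z)^{-1}$ in the Laurent expansion of [F] at
   [z]: [F] is a principal part at [z] plus a function regular at [z].  Taking
   m.+1 terms makes $c_0$ always occur; trailing coefficients may be zero. *)
Definition is_residue F z a : Prop :=
  exists (m : nat) (c : nat -> K) h,
    [/\ regular_at h z, F = principal_part m.+1 c z + h & c 0 = a].

Definition residue F z : K := xget 0 (is_residue F z).

Lemma regular_atB F G z : regular_at F z -> regular_at G z -> regular_at (F - G) z.
Proof.
move=> [u [v [vz ->]]] [u' [v' [vz' ->]]].
exists (u * v' - u' * v), (v * v'); rewrite hornerM mulf_neq0 //; split => //.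
have nz (p : {poly K}) : p.[z] != 0 -> tofrac p != 0.
  by move=> pz; rewrite tofrac_eq0; apply: contraNneq pz => ->; rewrite horner0.
by rewrite tofracB !tofracM -mulNr addf_div ?nz // mulNr.
Qed.

Lemma principal_part_regular m c z :
  regular_at (principal_part m c z) z -> forall k, (k < m)%N -> c k = 0.
Proof.
elim: m => [//|m IH] reg.
suff cm : c m = 0.
  move: reg; rewrite /principal_part big_ord_recr /= cm polyC0 tofrac0 mul0r addr0.
  by move=> /IH H k; rewrite ltnS leq_eqVlt => /predU1P[->|/H].
case: reg => u [v [vz E]].
have tX : tofrac ('X - z%:P) != 0 :> {fraction {poly K}}.
  by rewrite tofrac_eq0 polyXsubC_eq0.
have tv : tofrac v != 0.
  by rewrite tofrac_eq0; apply: contraNneq vz => ->; rewrite horner0.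
pose A := \sum_(k < m.+1) (c k)%:P * ('X - z%:P) ^+ (m - k).
have EA : A * v = u * ('X - z%:P) ^+ m.+1.
  apply/eqP; rewrite -tofrac_eq !tofracM tofracXn; apply/eqP.
  have -> : tofrac u = principal_part m.+1 c z * tofrac v by rewrite E divfK.
  rewrite mulrAC; congr (_ * _).
  rewrite /A rmorph_sum mulr_suml; apply: eq_bigr => k _ /=.
  rewrite tofracM tofracXn -mulrA; congr (_ * _).
  symmetry; exact: (mulVX_exp tX (ltn_ord k)).
have := congr1 (horner^~ z) EA; rewrite !hornerM horner_exp hornerXsubC subrr.
rewrite exprS mul0r mulr0 => /eqP; rewrite mulf_eq0 (negPf vz) orbF.
rewrite /A horner_sum big_ord_recr /= big1 ?add0r => [|k _].
  by rewrite subnn expr0 mulr1 hornerC => /eqP.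
by rewrite hornerM horner_exp hornerXsubC subrr expr0n subn_eq0 leqNgt ltn_ord mulr0.
Qed.

Lemma is_residue_uniq F z a b : is_residue F z a -> is_residue F z b -> a = b.
Proof.
have pad m M c : (m <= M)%N ->
    principal_part m c z = principal_part M (fun k => if (k < m)%N then c k else 0) z.
  move=> mM; rewrite /principal_part.
  rewrite (big_ord_widen _ (fun k => tofrac (c k)%:P / tofrac ('X - z%:P) ^+ k.+1) mM).
  rewrite big_mkcond; apply: eq_bigr => k _; case: ifP => // _.
  by rewrite polyC0 tofrac0 mul0r.
move=> [m [c [h [hr -> <-]]]] [m' [c' [h' [hr' E <-]]]].
pose M := maxn m.+1 m'.+1.
pose e k := (if (k < m.+1)%N then c k else 0) - (if (k < m'.+1)%N then c' k else 0).
suff /(_ 0%N) : forall k, (k < M)%N -> e k = 0.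
  by rewrite /e /= leq_max => /(_ isT)/eqP; rewrite subr_eq0 => /eqP.
apply: (@principal_part_regular _ _ z).
have -> : principal_part M e z = h' - h; last exact: regular_atB.
have -> : h' - h = principal_part m.+1 c z - principal_part m'.+1 c' z.
  by apply/eqP; rewrite subr_eq addrAC eq_sym subr_eq E addrC.
rewrite (pad m.+1 M) ?leq_maxl // (pad m'.+1 M) ?leq_maxr //.
rewrite /principal_part -sumrB; apply: eq_bigr => k _.
by rewrite -mulrBl -tofracB -polyCB.
Qed.

Lemma residueE F z a : is_residue F z a -> residue F z = a.
Proof.
move=> Fa; exact: is_residue_uniq (xgetPex 0 (ex_intro _ a Fa)) Fa.
Qed.

End Residues.

(* Main.v *)
Require Import Defs.
From mathcomp Require Import all_boot all_order all_algebra.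
From mathcomp Require Import reals complex.
From mathcomp Require Import ring zify.

Set Implicit Arguments.
Unset Strict Implicit.
Unset Printing Implicit Defensive.

Import GRing.Theory.
Local Open Scope ring_scope.

(** The polynomials P_m and Q_m solve the same three-term recurrence in m, so
by linearity the Casorati determinant

  C_(i,m) = P_m Q_i - P_i Q_m

solves it too, starting from C_(i,i) = 0 and the constant
C_(i,i+1) = d_1 ... d_i ([cross_succ]).  Two facts follow.

- The constant is nonzero, because every r_l is; hence P_n and Q_n have no
  common zero ([Ppol_Qpol_coprime]).  Moreover Q_n(0) = r_1 r_3 ... r_(2n-1)
  ([Qpol_at0]) is nonzero, so z_j is not 0 either.  The numerator s_0 w P_n
  therefore does not vanish at z_j, which is a genuine pole, simple because
  the zero is; its residue is the value at z_j of the numerator divided by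
  that of Q_n / (w - z_j) ([is_residue_simple_pole]).  Since the value of this
  cofactor is both Q_n'(z_j) and the product of the differences z_j - z_i,
  the first two formulas hold.

- The degree of C_(i,n) is at most n - 1 - i ([size_cross]), so it is n - 1
  for i = 0 only, where C_(0,n) = P_n is monic.  At a zero z_k of Q_n the
  polynomial C_(i,n) takes the value P_n(z_k) Q_i(z_k).  By Lagrange
  interpolation ([lagrange_top_coef]), the sum over k of
  Q_i(z_k) P_n(z_k) / Q_n'(z_k) is the coefficient of w^(n-1) in C_(i,n), that
  is 1 for i = 0 and 0 otherwise: the vector P_n(z_k) / Q_n'(z_k) is the first
  column of the inverse of T ([invmx_Tmx_col0]), which is the third formula.

The matrix T is invertible since it is a unitriangular matrix times a
Vandermonde matrix, and J T = T diag(z) is the recurrence for the Q_i at z_j,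
closed up in the last row by Q_n(z_j) = 0. *)

(* Keeps simplification from unfolding the recursive tables into case
   analyses on the index. *)
#[local] Arguments ftab : simpl never.
#[local] Arguments rcoef : simpl never.
#[local] Arguments ccoef : simpl never.
#[local] Arguments dcoef : simpl never.
#[local] Arguments Ppol : simpl never.
#[local] Arguments Qpol : simpl never.

(** * Coefficients of the recurrence *)

Section Coefficients.
Variables (K : fieldType) (s : nat -> K).

Lemma PpolSS m : Ppol s m.+2 =
  ('X - (ccoef s m.+1)%:P) * Ppol s m.+1 - (dcoef s m.+1)%:P * Ppol s m.
Proof. by []. Qed.

Lemma QpolSS m : Qpol s m.+2 =
  ('X - (ccoef s m.+1)%:P) * Qpol s m.+1 - (dcoef s m.+1)%:P * Qpol s m.
Proof. by []. Qed.

Lemma Qpol1 : Qpol s 1 = 'X - (ccoef s 0)%:P.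
Proof. by rewrite polyCN opprK. Qed.

Lemma rcoef_neq0 N l :
    (forall k, (k <= N)%N -> ftab s k.+2 0 != 0) ->
  (0 < l <= N)%N -> rcoef s l != 0.
Proof.
move=> f0 /andP[l_gt0 leN].
have nz m : (m <= N.+2)%N -> ftab s m 0 != 0.
  by case: m => [|[|m]] lem; rewrite ?oner_neq0 ?f0.
case: l l_gt0 leN => // l _ leN; rewrite /rcoef.
have f4 : [/\ ftab s l.+3 0 != 0, ftab s l 0 != 0,
             ftab s l.+1 0 != 0 & ftab s l.+2 0 != 0].
  by split; apply: nz; lia.
case: f4 => *; apply: mulf_neq0; first by rewrite signr_eq0.
by apply: mulf_neq0; [|apply: invr_neq0]; apply: mulf_neq0.
Qed.

Lemma dcoef_neq0 N l :
    (forall k, (k <= N)%N -> ftab s k.+2 0 != 0) ->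
  (0 < l)%N -> (2 * l <= N)%N -> dcoef s l != 0.
Proof.
move=> f0; case: l => // l _; rewrite /dcoef mulnS => leN.
by rewrite mulf_neq0 // (rcoef_neq0 f0) //= ltnW.
Qed.

Lemma ccoefS l :
  ccoef s l.+1 = - (rcoef s (2 * l).+2 + rcoef s (2 * l).+3).
Proof. by rewrite /ccoef mulnS. Qed.

Lemma dcoefS l : dcoef s l.+1 = rcoef s (2 * l).+1 * rcoef s (2 * l).+2.
Proof. by rewrite /dcoef mulnS. Qed.

(** At w = 0 the splitting of c_l and d_l into the r's makes the recurrence
telescope: (r_(2l) + r_(2l+1)) Q_l(0) - r_(2l-1) r_(2l) Q_(l-1)(0) reduces to
r_(2l+1) Q_l(0), as Q_l(0) = r_(2l-1) Q_(l-1)(0). *)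
Lemma Qpol_at0 m : (Qpol s m).[0] = \prod_(i < m) rcoef s (2 * i).+1.
Proof.
suff: (Qpol s m).[0] = \prod_(i < m) rcoef s (2 * i).+1 /\
      (Qpol s m.+1).[0] = \prod_(i < m.+1) rcoef s (2 * i).+1 by case.
elim: m => [|m [IH0 IH1]].
  by rewrite big_ord0 big_ord1 !hornerE.
split=> //; rewrite big_ord_recr -IH1 QpolSS.
rewrite !(hornerD, hornerN, hornerM, hornerX, hornerC) /=.
rewrite big_ord_recr -IH0 /= in IH1.
rewrite IH1 ccoefS dcoefS (_ : (2 * m.+1)%N = (2 * m).+2) ?mulnS //; ring.
Qed.

End Coefficients.

(** * Degrees of the two solutions *)

Section MonicSolutions.
Variable K : fieldType.
Implicit Types p q : {poly K}.

Lemma three_term_monic p q c d :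
    p \is monic -> (size q <= size p)%N ->
  let r := ('X - c%:P) * p - d%:P * q in
  r \is monic /\ size r = (size p).+1.
Proof.
move=> pm lepq /=.
have sXp : size (('X - c%:P) * p) = (size p).+1.
  by rewrite size_monicM ?monicXsubC ?monic_neq0 // size_XsubC.
have lt : (size (- (d%:P * q))%R < size (('X - c%:P) * p)%R)%N.
  rewrite size_polyN mul_polyC sXp ltnS.
  exact: leq_trans (size_scale_leq _ _) lepq.
split; last by rewrite size_polyDl.
by rewrite monicE lead_coefDl // -monicE monicMl ?monicXsubC.
Qed.

Variable s : nat -> K.

Lemma monic_size_Qpol m : Qpol s m \is monic /\ size (Qpol s m) = m.+1.
Proof.
suff: (Qpol s m \is monic /\ size (Qpol s m) = m.+1) /\
      (Qpol s m.+1 \is monic /\ size (Qpol s m.+1) = m.+2) by case.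
elim: m => [|m [[m0 s0] [m1 s1]]].
  split; first by rewrite monic1 size_poly1.
  by rewrite Qpol1 monicXsubC size_XsubC.
split=> //; rewrite -{3}s1; apply: three_term_monic => //.
by rewrite s0 s1.
Qed.

Lemma monic_size_Ppol m : Ppol s m.+1 \is monic /\ size (Ppol s m.+1) = m.+1.
Proof.
suff: (Ppol s m.+1 \is monic /\ size (Ppol s m.+1) = m.+1) /\
      (size (Ppol s m) <= m)%N by case.
elim: m => [|m [[m1 s1] s0]].
  by rewrite monic1 size_poly1 size_poly0.
split; last by rewrite s1.
rewrite -{3}s1; apply: three_term_monic => //.
by rewrite s1 ltnW.
Qed.

End MonicSolutions.

(** * Casorati determinants *)

Section Casorati.
Variables (K : fieldType) (s : nat -> K).

(** The Casorati determinant of the solutions P and Q between two arbitrary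
indices: i is fixed and m is the variable of the recurrence. *)
Definition cross i m : {poly K} :=
  Ppol s m * Qpol s i - Ppol s i * Qpol s m.

Lemma crossSS i m :
  cross i m.+2 = ('X - (ccoef s m.+1)%:P) * cross i m.+1
                 - (dcoef s m.+1)%:P * cross i m.
Proof.
by rewrite /cross PpolSS QpolSS; ring.
Qed.

(** One step of the recurrence multiplies the Casorati determinant of
consecutive indices by d, the determinant of the transfer matrix. *)
Lemma cross_succ i : cross i i.+1 = (\prod_(k < i) dcoef s k.+1)%:P.
Proof.
elim: i => [|i IH]; first by rewrite big_ord0 /cross /= mul1r mul0r subr0.
rewrite big_ord_recr polyCM /= -IH /cross PpolSS QpolSS; ring.
Qed.

(** In the variable m, [cross i] solves the recurrence with initial values 0
and a constant, so each step past i.+1 raises the degree by at most one: the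
terms of P_m Q_i and P_i Q_m of degree at least m - i cancel. *)
Lemma size_cross i k : (size (cross i (i + k)%N) <= k)%N.
Proof.
suff: (size (cross i (i + k)%N) <= k)%N /\
      (size (cross i (i + k).+1) <= k.+1)%N by case.
elim: k => [|k [le0 le1]].
  by rewrite addn0 [cross i i]subrr size_poly0 cross_succ size_polyC_leq1.
rewrite addnS; split=> //; rewrite crossSS.
apply: leq_trans (size_polyD _ _) _; rewrite geq_max size_polyN; apply/andP; split.
  by apply: leq_trans (size_polyMleq _ _) _; rewrite size_XsubC.
by rewrite mul_polyC (leq_trans (size_scale_leq _ _)) // (leq_trans le0) ?leqW.
Qed.

(** A common zero would be a zero of the nonzero constant [cross m m.+1]. *)
Lemma Ppol_Qpol_coprime m x :
    (forall k, (k < m)%N -> dcoef s k.+1 != 0) ->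
  root (Qpol s m.+1) x -> (Ppol s m.+1).[x] != 0.
Proof.
move=> d0 /rootP Qx; apply/eqP => Px.
have := congr1 (horner^~ x) (cross_succ m).
rewrite hornerC hornerD hornerN !hornerM Px Qx mul0r mulr0 subrr => /esym/eqP.
by apply/negP/prodf_neq0 => k _; apply: d0.
Qed.

End Casorati.

(** * Lagrange interpolation *)

Section Nodes.
Variables (K : fieldType) (n : nat) (z : 'I_n.+1 -> K).
Hypothesis z_inj : injective z.

Lemma nodal_neq0 j : \prod_(i | i != j) (z j - z i) != 0.
Proof.
apply/prodf_neq0 => i; apply: contraNneq => /eqP.
by rewrite subr_eq0 => /eqP/z_inj->.
Qed.

(** Each polynomial W_j of the Lagrange basis, before normalization, is monic of
degree n, so the coefficient of degree n of the interpolation formula for g is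
the sum of its weights. *)
Lemma lagrange_top_coef (g : {poly K}) : (size g <= n.+1)%N ->
  \sum_j g.[z j] / \prod_(i | i != j) (z j - z i) = g`_n.
Proof.
move=> leg.
pose W j : {poly K} := \prod_(i | i != j) ('X - (z i)%:P).
pose a j := g.[z j] / \prod_(i | i != j) (z j - z i).
have Wz j k : (W j).[z k] = \prod_(i | i != j) (z k - z i).
  by rewrite horner_prod; apply: eq_bigr => i _; rewrite hornerXsubC.
have sW j : size (W j) = n.+1.
  rewrite /W -big_filter size_prod_XsubC -[filter _ _]/(filter (predC1 j) _).
  rewrite -rem_filter ?index_enum_uniq // size_rem ?mem_index_enum //=.
  by rewrite [index_enum _]unlock -enumT size_enum_ord.
suff g_interp : g = \sum_j a j *: W j.
  rewrite [in RHS]g_interp coef_sum; apply: eq_bigr => j _.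
  have /monicP : W j \is monic := monic_prod_XsubC _ (fun i => i != j) z.
  by rewrite coefZ lead_coefE sW => ->; rewrite mulr1.
apply/eqP; rewrite -subr_eq0; apply/eqP.
apply: (@roots_geq_poly_eq0 _ _ [seq z j | j <- enum 'I_n.+1]).
- apply/allP => _ /mapP[k _ ->]; rewrite rootE hornerD hornerN horner_sum.
  rewrite (bigD1 k) //= big1 ?addr0 => [|j jk].
    by rewrite hornerZ Wz divfK ?subrr // nodal_neq0.
  by rewrite hornerZ Wz (bigD1 k) 1?eq_sym //= subrr mul0r mulr0.
- by rewrite map_inj_uniq ?enum_uniq.
- rewrite size_map size_enum_ord (leq_trans (size_polyD _ _)) // geq_max leg.
  rewrite size_polyN (leq_trans (size_sum _ _ _)) //; apply/bigmax_leqP => j _.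
  by rewrite (leq_trans (size_scale_leq _ _)) // sW.
Qed.

End Nodes.

(** * Eigenvectors of the Jacobi matrix *)

Section Diagonalisation.
Variables (K : fieldType) (s : nat -> K) (n : nat) (z : n.-tuple K).

(** The passage from the monomials to the monic polynomials Q_i is
unitriangular, which reduces the claim to the Vandermonde determinant. *)
Lemma Tmx_unit : uniq z -> Tmx s z \in unitmx.
Proof.
move=> uz; pose L : 'M[K]_n := \matrix_(i, k) (Qpol s i)`_k.
pose a := \row_j tnth z j.
have -> : Tmx s z = L *m Vandermonde n a.
  apply/matrixP => i j; rewrite !mxE (@horner_coef_wide _ n).
    by apply: eq_bigr => k _; rewrite !mxE.
  by rewrite (monic_size_Qpol s i).2.
rewrite unitmx_mul; apply/andP; split; rewrite unitmxE unitfE.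
  rewrite det_trig.
    apply/prodf_neq0 => i _; rewrite mxE.
    have [/monicP + si] := monic_size_Qpol s i.
    by rewrite lead_coefE si => ->; rewrite oner_neq0.
  apply/is_trig_mxP => i k ik; rewrite mxE nth_default //.
  by rewrite (monic_size_Qpol s i).2.
rewrite det_Vandermonde; apply/prodf_neq0 => i _; apply/prodf_neq0 => j ij.
rewrite !mxE subr_eq0; apply: contraTneq ij => /(tuple_uniqP _ uz)->.
by rewrite ltnn.
Qed.

(** The hypothesis g n = 0 lets the last row, which has no superdiagonal
entry, be written like the others. *)
Lemma Jmx_row (g : nat -> K) (i : 'I_n) : g n = 0 ->
  \sum_k Jmx s n i k * g k =
  ccoef s i * g i + g i.+1 + (if i : nat is i'.+1 then dcoef s i * g i' else 0).
Proof.
move=> gn.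
have pick m : \sum_(k < n) (k == m :> nat)%:R * g k = if (m < n)%N then g m else 0.
  case: ltnP => mn.
    rewrite (bigD1 (Ordinal mn)) //= eqxx mul1r big1 ?addr0 // => k.
    by rewrite -val_eqE /= => /negbTE->; rewrite mul0r.
  by rewrite big1 // => k _; rewrite ltn_eqF ?mul0r // (leq_trans (ltn_ord k)).
transitivity (\sum_(k < n) (ccoef s i * ((k == i :> nat)%:R * g k)
   + (k == i.+1 :> nat)%:R * g k + dcoef s i * ((i == k.+1 :> nat)%:R * g k))).
  apply: eq_bigr => k _; rewrite mxE -(val_eqE i k) (eq_sym (val i)) /=.
  case: (ltngtP k i) => [ki|ik|->].
  - by rewrite (ltn_eqF (leqW ki)); case: eqP => _; rewrite /=; ring.
  - by rewrite (ltn_eqF (leqW ik)); case: eqP => _; rewrite /=; ring.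
  - by rewrite !ltn_eqF //; rewrite /=; ring.
rewrite !big_split /= -!mulr_sumr !pick ltn_ord; congr (_ + _ + _).
  case: ltnP => // lei; rewrite (_ : i.+1 = n) ?gn //.
  by apply/eqP; rewrite eqn_leq lei ltn_ord.
case: (nat_of_ord i) (ltn_ord i) => [|i'] lti.
  by rewrite big1 ?mulr0 // => k _; rewrite mul0r.
have := pick i'; rewrite (ltnW lti) => <-; congr (_ * _).
by apply: eq_bigr => k _; rewrite eqSS eq_sym.
Qed.

Lemma Jmx_diag : uniq z -> all (root (Qpol s n)) z ->
  Jmx s n = Tmx s z *m diag_mx (\row_j tnth z j) *m invmx (Tmx s z).
Proof.
move=> uz /allP rz; rewrite -[LHS](mulmxK (Tmx_unit uz)); congr (_ *m _).
apply/matrixP => i j; rewrite mul_mx_diag !mxE.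
under eq_bigr => k _ do rewrite [Tmx _ _ _ _]mxE.
rewrite (@Jmx_row (fun k => (Qpol s k).[tnth z j])); last first.
  by apply/rootP/rz/mem_tnth.
case: (nat_of_ord i) => [|l].
  by rewrite Qpol1 hornerXsubC hornerC; ring.
by rewrite QpolSS !(hornerD, hornerN, hornerM, hornerX, hornerC); ring.
Qed.

End Diagonalisation.

(** * Polynomials and their lists of zeros *)

Lemma mem_zeros_of (K : fieldType) (p : {poly K}) (z : seq K) x :
  p != 0 -> zeros_of p z -> (x \in z) = root p x.
Proof.
move=> p0 pz.
by rewrite root_factor_theorem XsubC_dvd // -pz -has_count has_pred1.
Qed.

Lemma simple_zeros_uniq (K : fieldType) (p : {poly K}) (z : seq K) :
  p != 0 -> zeros_of p z -> simple_zeros p -> uniq z.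
Proof.
move=> p0 pz p_simple; apply: count_mem_uniq => x.
have [xz|/count_memPn->//] := boolP (x \in z).
by rewrite pz p_simple // -(mem_zeros_of _ p0 pz).
Qed.

(** Over a closed field a monic polynomial is determined by its zeros with
their multiplicities. *)
Lemma zeros_of_prod (K : closedFieldType) (p : {poly K}) (z : seq K) :
  p \is monic -> zeros_of p z -> p = \prod_(x <- z) ('X - x%:P).
Proof.
move=> pm pz; have [r pr] := closed_field_poly_normal p.
move: pr; rewrite (monicP pm) scale1r => pr; rewrite {1}pr.
apply: perm_big; apply/allP => x _ /=.
by rewrite pz pr mu_prod_XsubC.
Qed.

(** * Residues at simple poles *)

Section SimplePoles.
Variables (K : fieldType) (z : K) (u q : {poly K}).
Hypothesis qz : q.[z] != 0.
Let F := tofrac u / tofrac (('X - z%:P) * q).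

(** With a = u(z) / q(z), the polynomial u - a q is divisible by w - z, so
F - a / (w - z) can be written with the denominator q, which does not vanish
at z. *)
Lemma is_residue_simple_pole : is_residue F z (u.[z] / q.[z]).
Proof.
set a := u.[z] / q.[z].
have /factor_theorem[g Eg] : root (u - a%:P * q) z.
  by rewrite rootE !hornerE divfK ?subrr.
exists 0%N, (fun=> a), (tofrac g / tofrac q); split=> //; first by exists g, q.
have tX : tofrac ('X - z%:P) != 0 :> {fraction {poly K}}.
  by rewrite tofrac_eq0 polyXsubC_eq0.
have tq : tofrac q != 0.
  by rewrite tofrac_eq0; apply: contraNneq qz => ->; rewrite horner0.
rewrite /F /principal_part big_ord1 expr1.
have -> : u = a%:P * q + g * ('X - z%:P) by rewrite -Eg; ring.
by rewrite tofracD 3!tofracM [RHS](addf_div _ _ tX tq).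
Qed.

(** A function regular at z has residue 0 there, and residues are unique. *)
Lemma is_pole_simple_pole : u.[z] != 0 -> is_pole F z.
Proof.
move=> uz regF; have Fz0 : is_residue F z 0.
  exists 0%N, (fun=> 0), F; split=> //.
  by rewrite /principal_part big_ord1 polyC0 tofrac0 mul0r add0r.
have /eqP := is_residue_uniq Fz0 is_residue_simple_pole.
by rewrite eq_sym mulf_eq0 invr_eq0 (negbTE uz) (negbTE qz).
Qed.

End SimplePoles.

(** * First column of the inverse eigenvector matrix *)

Section Inverse.
Variables (K : fieldType) (s : nat -> K) (n : nat) (z : n.+1.-tuple K).
Hypothesis z_uniq : uniq z.
Hypothesis Qz : all (root (Qpol s n.+1)) z.

(** Row i of T times the claimed column is, by [lagrange_top_coef], the
coefficient of degree n of [cross i n.+1], whose values at the zeros of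
Q_(n+1) are those of P_(n+1) Q_i; [size_cross] makes it vanish unless i = 0. *)
Lemma invmx_Tmx_col0 j : invmx (Tmx s z) j ord0 =
  (Ppol s n.+1).[tnth z j] / \prod_(i | i != j) (tnth z j - tnth z i).
Proof.
pose x := \col_k ((Ppol s n.+1).[tnth z k]
                  / \prod_(i | i != k) (tnth z k - tnth z i)).
suff Tx : Tmx s z *m x = delta_mx ord0 ord0.
  have -> : invmx (Tmx s z) j ord0 = col ord0 (invmx (Tmx s z)) j ord0.
    by rewrite mxE.
  by rewrite colE -Tx mulKmx ?Tmx_unit // mxE.
apply/colP => i; rewrite !mxE eqxx andbT.
transitivity (\sum_k (cross s i n.+1).[tnth z k]
                / \prod_(l | l != k) (tnth z k - tnth z l)).
  apply: eq_bigr => k _; rewrite !mxE mulrA; congr (_ / _).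
  have /rootP Qk := allP Qz _ (mem_tnth k z).
  by rewrite hornerD hornerN !hornerM Qk mulr0 subr0 mulrC.
have lt_i := ltnW (ltn_ord i).
have := size_cross s i (n.+1 - i); rewrite subnKC // => le_cross.
rewrite lagrange_top_coef; first last.
- exact: leq_trans le_cross (leq_subr _ _).
- exact/tuple_uniqP.
case: (unliftP ord0 i) le_cross => [i'|] -> le_cross.
  by rewrite nth_default // (leq_trans le_cross) //= subSS leq_subr.
rewrite /cross -[Qpol s _]/1 -[Ppol s (ord0 : 'I_n.+1)]/0 mulr1 mul0r subr0.
have [/monicP] := monic_size_Ppol s n.
by rewrite lead_coefE => + sP; rewrite sP.
Qed.

End Inverse.

Theorem theorem11 (R : realType) (n : nat) (n_ge1 : (1 <= n)%N)
    (s : nat -> R[i])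
    (f_neq0 : forall l : nat, (l <= 2 * n - 1)%N -> ftab s l.+2 0 != 0)
    (z : n.-tuple R[i]) (z_zeros : zeros_of (Qpol s n) z)
    (lam : n.-1.-tuple R[i]) (lam_zeros : zeros_of (Ppol s n) lam)
    (Q_simple : simple_zeros (Qpol s n)) :
  let T : 'M[R[i]]_n := Tmx s z in
  [/\ T \in unitmx,
      Jmx s n = T *m diag_mx (\row_j tnth z j) *m invmx T
    & forall j : 'I_n,
      let zj := tnth z j in
      let rho := residue (Zpade s n) zj in
      [/\ is_pole (Zpade s n) zj,
          is_residue (Zpade s n) zj rho,
          rho = s 0%N * zj * ((\prod_(i < n.-1) (zj - tnth lam i))
                              / (\prod_(i < n | i != j) (zj - tnth z i))),
          rho = s 0%N * zj * ((Ppol s n).[zj] / (Qpol s n)^`().[zj])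
        & rho = s 0%N * zj * invmx T j (Ordinal n_ge1)]].
Proof.
case: n n_ge1 f_neq0 z z_zeros lam lam_zeros Q_simple =>
  // n n_ge1 f0 z Qz lam Pl Qs T.
have [Qm _] := monic_size_Qpol s n.+1.
have [Pm _] := monic_size_Ppol s n.
have Q0 := monic_neq0 Qm.
have uz : uniq z := simple_zeros_uniq Q0 Qz Qs.
have rz : all (root (Qpol s n.+1)) z.
  by apply/allP => x; rewrite (mem_zeros_of _ Q0 Qz).
have z_inj : injective (tnth z) by apply/tuple_uniqP.
split=> [||j zj]; [exact: Tmx_unit | exact: Jmx_diag |].
pose q := \prod_(i | i != j) ('X - (tnth z i)%:P).
have QE : Qpol s n.+1 = ('X - zj%:P) * q.
  by rewrite (zeros_of_prod Qm Qz) big_tuple (bigD1 j).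
have qE : q.[zj] = \prod_(i | i != j) (zj - tnth z i).
  by rewrite horner_prod; apply: eq_bigr => i _; rewrite hornerXsubC.
have q0 : q.[zj] != 0 by rewrite qE nodal_neq0.
have Q'E : (Qpol s n.+1)^`().[zj] = q.[zj].
  rewrite QE derivM derivXsubC mul1r hornerD hornerM hornerXsubC.
  by rewrite subrr mul0r addr0.
have PE : (Ppol s n.+1).[zj] = \prod_(i < n) (zj - tnth lam i).
  rewrite {1}(zeros_of_prod Pm Pl) big_tuple horner_prod.
  by apply: eq_bigr => i _; rewrite hornerXsubC.
have Qj : root (Qpol s n.+1) zj by apply: (allP rz); apply: mem_tnth.
pose u := s 0%N *: ('X * Ppol s n.+1).
have uE : u.[zj] = s 0%N * zj * (Ppol s n.+1).[zj].
  by rewrite hornerZ hornerM hornerX mulrA.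
have zj0 : zj != 0.
  apply: contraTneq Qj => ->; rewrite rootE Qpol_at0; apply/prodf_neq0 => i _.
  by apply: (rcoef_neq0 f0); have := ltn_ord i; lia.
have P0 : (Ppol s n.+1).[zj] != 0.
  apply: Ppol_Qpol_coprime Qj => k lt_kn.
  by apply: (dcoef_neq0 f0); lia.
have u0 : u.[zj] != 0 by rewrite uE !mulf_neq0 // (f0 0%N).
have FE : Zpade s n.+1 = tofrac u / tofrac (('X - zj%:P) * q) by rewrite -QE.
have res := is_residue_simple_pole u q0.
rewrite /= FE (residueE res) Q'E -PE -qE uE mulrA.
split=> //; [exact: is_pole_simple_pole | by rewrite -uE |].
have -> : Ordinal n_ge1 = ord0 by apply: val_inj.
by rewrite (invmx_Tmx_col0 uz rz) -qE mulrA.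
Qed.
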